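(* Let $C>0$ and let $P$ be the law of a random vector $X=(X_1,\dots,X_n)$ in $\mathbb R^n$. Let $A\subset\mathbb R^n$ be a measurable set and $B$ its convex hull, and let $d_N(x,B)=\inf_{y\in B}\|x-y\|$ be the Euclidean distance to $B$. If $P$ satisfies $\tilde T_{2,N}(C)$ and $\tilde T^{(i)}_{2,N}(C)$, then (with $1/0=+\infty$) $$P\Big[\exp\Big(\frac{d_N^2(X,B)}{4C}\Big)\Big]\le\frac1{P(A)}.$$
   Context: Notation: $P[h]=\int h\,dP$; $N(x,y)=\|x-y\|$ is the Euclidean metric on $E=\mathbb R^n$; $M^+(E)$ is the set of non-negative lower semi-continuous functions on $E$; $\mathcal K(Q|P)=Q[\log(dQ/dP)]$. Convention: $+\infty/+\infty=0/0=0$. $$\tilde W_{2,N}(P,Q)=\sup_{\alpha\in M^+(E)}\ \inf_{\pi}\ \frac{\pi[\alpha(Y)\|X-Y\|]}{Q[\alpha^2]^{1/2}},$$ the infimum being over all couplings $\pi$ of $(X,Y)$ with $X\sim P$, $Y\sim Q$. $P$ satisfies $\tilde T_{2,N}(C)$ if $\tilde W_{2,N}(P,Q)\le\sqrt{2C\mathcal K(Q|P)}$ for all probability measures $Q$ on $\mathbb R^n$; it satisfies $\tilde T^{(i)}_{2,N}(C)$ if $\tilde W_{2,N}(Q,P)\le\sqrt{2C\mathcal K(Q|P)}$ for all $Q$. *)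

(* Defs.v *)
From HB Require Import structures.
From mathcomp Require Export all_boot all_order all_algebra.
From mathcomp Require Export all_classical all_reals all_analysis.

Set Implicit Arguments.
Unset Strict Implicit.
Unset Printing Implicit Defensive.

Import Order.TTheory GRing.Theory Num.Theory.
Import numFieldNormedType.Exports.

Local Open Scope classical_set_scope.
Local Open Scope ring_scope.

(* 'rV[R]_n carries its Borel sigma-algebra, generated by the open sets of the
   library topology on matrices, which is the usual topology of R^n. *)
Section borel_row_vectors.
Variables (R : realType) (n : nat).

Let rV_measurable : set (set 'rV[R]_n) := <<s @open 'rV[R]_n >>.

Let rV_measurable0 : rV_measurable set0.
Proof. exact: sigma_algebra0. Qed.

Let rV_measurableC A : rV_measurable A -> rV_measurable (~` A).
Proof. exact: sigma_algebraC. Qed.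

Let rV_measurable_bigcup (F : (set 'rV[R]_n)^nat) :
  (forall i, rV_measurable (F i)) -> rV_measurable (\bigcup_i F i).
Proof. exact: sigma_algebra_bigcup. Qed.

HB.instance Definition _ := @isMeasurable.Build
  (sigma_display (@open 'rV[R]_n)) 'rV[R]_n rV_measurable
  rV_measurable0 rV_measurableC rV_measurable_bigcup.

End borel_row_vectors.

Section definitions.
Variables (R : realType) (n : nat).
Implicit Types (P Q : probability 'rV[R]_n R) (A B : set 'rV[R]_n).

(* The library norm `|x| on matrices is the sup norm. *)
Definition enorm (x : 'rV[R]_n) : R := Num.sqrt (\sum_(i < n) x ord0 i ^+ 2).

Definition lsc_nneg : set ('rV[R]_n -> R) :=
  [set alpha | (forall x, 0 <= alpha x) /\
               lower_semicontinuous (fun x => (alpha x)%:E)].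

Definition couplings P Q : set (probability ('rV[R]_n * 'rV[R]_n)%type R) :=
  [set pi | (forall A, measurable A -> pi (fst @^-1` A) = P A) /\
            (forall A, measurable A -> pi (snd @^-1` A) = Q A)].

Local Open Scope ereal_scope.
Local Open Scope charge_scope.

(* The quotient of \bar R satisfies +oo / +oo = 0 and 0 / 0 = 0. *)
Definition tW2 P Q : \bar R :=
  ereal_sup [set
    ereal_inf [set
      (\int[pi]_z (alpha z.2 * enorm (z.1 - z.2))%:E) /
      sqrte (\int[Q]_y (alpha y ^+ 2)%:E)
    | pi in couplings P Q]
  | alpha in lsc_nneg].

(* Relative entropy: +oo unless Q is absolutely continuous with respect to P. *)
Definition KL Q P : \bar R :=
  if `[< Q `<< P >] then
    \int[Q]_x lne ('d (charge_of_finite_measure Q) '/d P x)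
  else +oo.

Definition tT2 (C : R) P : Prop :=
  forall Q, tW2 P Q <= sqrte ((2 * C)%:E * KL Q P).

Definition tT2i (C : R) P : Prop :=
  forall Q, tW2 Q P <= sqrte ((2 * C)%:E * KL Q P).

Definition convex_hull A : set 'rV[R]_n :=
  smallest (@convex_set R 'rV[R]_n) A.

(* +oo when B is empty *)
Definition edistance (x : 'rV[R]_n) B : \bar R :=
  ereal_inf [set (enorm (x - y))%:E | y in B].

End definitions.

(* Main.v *)
(* Let f = min(d(., B), M): a bounded non-negative 1-Lipschitz function vanishing
   on A.  For a coupling (X, Y) of laws Q1, Q2,
     f(Y)^2 <= f(Y) f(X) + f(Y) |X - Y|,
   so testing the weak cost with alpha := f and optimizing the AM-GM bound of
   f(Y) f(X) gives
     Q2[f^2]^(1/2) <= Q1[f^2]^(1/2) + tW2 Q1 Q2.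
   Apply this from P(. | A), where f vanishes, to P, and then from P to the Gibbs
   measure Q proportional to exp(f^2 / 4C) P, with normalizing constant Z.  The
   entropies are - ln P(A) and Q[f^2] / 4C - ln Z, so
     Q[f^2] <= 4C (- ln P(A) + Q[f^2] / 4C - ln Z),
   that is Z <= 1 / P(A); let M tend to infinity. *)
From HB Require Import structures.
Require Import Defs.
From mathcomp Require Import measurable_realfun ring lra.

Set Implicit Arguments.
Unset Strict Implicit.
Unset Printing Implicit Defensive.

Import Order.TTheory GRing.Theory Num.Theory.
Import numFieldNormedType.Exports.

Local Open Scope classical_set_scope.
Local Open Scope ring_scope.

(** * Euclidean norm: Cauchy-Schwarz, continuity and Borel measurability *)

Section euclidean_norm.
Context {R : realType} {n : nat}.
Implicit Types (x y : 'rV[R]_n) (B : set 'rV[R]_n) (f : 'rV[R]_n -> R).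

Lemma enorm_ge0 x : 0 <= enorm x. Proof. exact: sqrtr_ge0. Qed.

Lemma enorm0 : enorm (0 : 'rV[R]_n) = 0.
Proof. by rewrite /enorm big1 ?sqrtr0// => i _; rewrite mxE expr0n. Qed.

Lemma enormN x : enorm (- x) = enorm x.
Proof. by rewrite /enorm; under eq_bigr do rewrite mxE sqrrN. Qed.

Lemma sqr_enorm x : enorm x ^+ 2 = \sum_(i < n) x ord0 i ^+ 2.
Proof. by rewrite sqr_sqrtr// sumr_ge0// => i _; rewrite sqr_ge0. Qed.

Lemma coord_le_enorm x i : `|x ord0 i| <= enorm x.
Proof.
rewrite -sqrtr_sqr ler_wsqrtr// (bigD1 i)//= lerDl sumr_ge0// => j _.
exact: sqr_ge0.
Qed.

(** Cauchy-Schwarz, by expanding the sum of the squares of [enorm y * x_i - enorm x * y_i] and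
    cancelling the product of the two norms; a vanishing norm is treated apart. *)
Lemma dot_le_enorm x y :
  \sum_(i < n) x ord0 i * y ord0 i <= enorm x * enorm y.
Proof.
have [x0|x0] := eqVneq (enorm x) 0.
  rewrite x0 mul0r big1// => i _.
  have := coord_le_enorm x i.
  by rewrite x0 normr_le0 => /eqP ->; rewrite mul0r.
have [y0|y0] := eqVneq (enorm y) 0.
  rewrite y0 mulr0 big1// => i _.
  have := coord_le_enorm y i.
  by rewrite y0 normr_le0 => /eqP ->; rewrite mulr0.
have xy0 : 0 < enorm x * enorm y.
  by rewrite mulr_gt0// lt_neqAle enorm_ge0 eq_sym ?x0 ?y0.
rewrite -(ler_pM2l xy0).
have : 0 <= \sum_(i < n) (enorm y * x ord0 i - enorm x * y ord0 i) ^+ 2.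
  by rewrite sumr_ge0// => i _; rewrite sqr_ge0.
have -> : \sum_(i < n) (enorm y * x ord0 i - enorm x * y ord0 i) ^+ 2 =
    enorm y ^+ 2 * enorm x ^+ 2 + enorm x ^+ 2 * enorm y ^+ 2
    - 2 * (enorm x * enorm y) * \sum_(i < n) x ord0 i * y ord0 i.
  rewrite {1}(sqr_enorm x) {2}(sqr_enorm y).
  rewrite !mulr_sumr -big_split/= -sumrB.
  by apply: eq_bigr => i _; ring.
nra.
Qed.

Lemma ler_enormD x y : enorm (x + y) <= enorm x + enorm y.
Proof.
rewrite -(@ler_pXn2r _ 2)// ?nnegrE ?addr_ge0 ?enorm_ge0//.
rewrite sqrrD !sqr_enorm.
apply: (@le_trans _ _ (\sum_(i < n) x ord0 i ^+ 2 +
   (\sum_(i < n) x ord0 i * y ord0 i) *+ 2 + \sum_(i < n) y ord0 i ^+ 2)).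
  rewrite -sumrMnl -!big_split/=.
  by apply: ler_sum => i _; rewrite mxE sqrrD.
by rewrite lerD2r lerD2l lerMn2r dot_le_enorm orbT.
Qed.

(** The topology on matrices is that of the sup norm, so continuity goes through the coordinates. *)
Lemma enormB_continuous (a : 'rV[R]_n) : continuous (fun x => enorm (x - a)).
Proof.
have ci i : continuous (fun x : 'rV[R]_n => (x ord0 i - a ord0 i) ^+ 2).
  move=> x; apply: (@continuous_comp _ _ _
    (fun x : 'rV[R]_n => x ord0 i - a ord0 i) (fun r => r ^+ 2));
    last exact: exprn_continuous.
  by apply: continuousB; [exact: coord_continuous|exact: cst_continuous].
move=> x; apply: (@continuous_comp _ _ _
  (fun x : 'rV[R]_n => \sum_(i < n) (x - a) ord0 i ^+ 2) Num.sqrt);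
  last exact: sqrt_continuous.
apply: (@cvg_big _ _ _ _ _ _ _ (nbhs x)) => [|i _].
  exact: pseudometric_normed_Zmodule.add_continuous.
rewrite (_ : (fun y => _) = fun y => (y ord0 i - a ord0 i) ^+ 2); last first.
  by apply/funext => y; rewrite !mxE.
have := ci i x; rewrite /continuous_at.
by rewrite [X in _ --> X -> _](_ : _ = (x - a) ord0 i ^+ 2)// !mxE.
Qed.

(** Exchanging [x] and [y] turns the one-sided bound into a two-sided one, and [f] is squeezed at
    [x]. *)
Lemma enorm_lipschitz_continuous f :
  (forall x y, f x <= f y + enorm (x - y)) -> continuous f.
Proof.
move=> fL x.
have e0 : enorm (y - x) @[y --> x] --> (0 : R).
  by have := @enormB_continuous x x; rewrite /continuous_at subrr enorm0.
apply: (@squeeze_cvgr _ (nbhs x) _ _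
  (fun y => f x - enorm (y - x)) (fun y => f x + enorm (y - x))).
- near=> y; rewrite fL andbT lerBlDr.
  by rewrite (le_trans (fL x y))// -enormN opprB.
- by rewrite -[X in _ --> X]subr0; apply: cvgB => //; exact: cvg_cst.
- by rewrite -[X in _ --> X]addr0; apply: cvgD => //; exact: cvg_cst.
Unshelve. all: by end_near. Qed.

Lemma continuous_measurable_rV f : continuous f -> measurable_fun setT f.
Proof.
move=> cf; apply: (measurability _ (RGenOpens.measurableE R)).
move=> /= _ [_ [a [b ->]]] <-; rewrite setTI; apply: sub_sigma_algebra.
by apply: open_comp => //; exact: interval_open.
Qed.

Lemma continuous_lsc_nneg f :
  continuous f -> (forall x, 0 <= f x) -> lsc_nneg f.
Proof.
move=> cf f0; split => //; apply/lower_semicontinuousP => a.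
rewrite (_ : [set _ | _] = f @^-1` `]a, +oo[%classic); last first.
  by apply/seteqP; split => x /=; rewrite lte_fin in_itv/= andbT.
by apply: open_comp => //; exact: interval_open.
Qed.

(** Pairs carry the product sigma-algebra, so the argument is coordinatewise and does not go through
    joint continuity. *)
Lemma measurable_enormB :
  measurable_fun setT (fun z : 'rV[R]_n * 'rV[R]_n => enorm (z.1 - z.2)).
Proof.
have mc i : measurable_fun setT (fun x : 'rV[R]_n => x ord0 i).
  by apply: continuous_measurable_rV; exact: coord_continuous.
have msqrt : measurable_fun setT (@Num.sqrt R).
  by apply: continuous_measurable_fun; exact: sqrt_continuous.
rewrite /enorm; apply: (measurableT_comp msqrt).
apply: measurable_sum => i; apply: measurable_funX.
rewrite (_ : (fun z => _) = fun z : 'rV[R]_n * 'rV[R]_n =>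
  z.1 ord0 i - z.2 ord0 i); last by apply/funext => z; rewrite !mxE.
by apply: measurable_funB; apply: (measurableT_comp (mc i)).
Qed.

End euclidean_norm.

Local Open Scope ereal_scope.

(** * Probability measures with a density: integrals and relative entropy *)

Section density.
Local Open Scope charge_scope.
Context {d} {T : measurableType d} {R : realType}.
Context {P : probability T R} {h : T -> R}.
Hypotheses (mh : measurable_fun setT h) (h0 : forall x, (0 <= h x)%R).

Lemma density_probability : \int[P]_x (h x)%:E = 1 ->
  exists Q : probability T R,
    forall A, measurable A -> Q A = \int[P]_(x in A) (h x)%:E.
Proof.
move=> h1; pose q A := \int[P]_(x in A) (h x)%:E.
have q0 : q set0 = 0 by rewrite /q integral_set0.
have qge0 A : 0 <= q A by apply: integral_ge0 => x _; rewrite lee_fin.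
have qsig : semi_sigma_additive q.
  apply: semi_sigma_additive_nng_induced; first exact/measurable_EFinP.
  by move=> x; rewrite lee_fin.
pose qm := isMeasure.Build _ _ _ q q0 qge0 qsig.
pose qM : {measure set T -> \bar R} := HB.pack q qm.
pose qp := Measure_isProbability.Build _ _ _ qM h1.
pose Q : probability T R := HB.pack q qm qp.
by exists Q.
Qed.

Context {Q : probability T R}.
Hypothesis QE : forall A, measurable A -> Q A = \int[P]_(x in A) (h x)%:E.

Let mEh : measurable_fun setT (EFin \o h).
Proof. exact/measurable_EFinP. Qed.

Lemma density_dominates : Q `<< P.
Proof.
apply/null_content_dominatesP => A mA PA0; rewrite QE//.
by apply: null_set_integral => //; exact: measurable_funTS.
Qed.

(** Both functions integrate to [Q E] over every measurable [E], hence agree a.e. *)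
Lemma Radon_Nikodym_density :
  ae_eq P setT ('d (charge_of_finite_measure Q) '/d P) (EFin \o h).
Proof.
have QP := density_dominates.
apply: integral_ae_eq => //; first exact: Radon_Nikodym_integrable.
by move=> E _ mE; rewrite -Radon_Nikodym_integral// -QE.
Qed.

(** Change of variables holds for the [Radon_Nikodym_SigmaFinite] version of the derivative, which
    is [P]-a.e. equal to [h]. *)
Lemma ge0_integral_density (f : T -> \bar R) :
  (forall x, 0 <= f x) -> measurable_fun setT f ->
  \int[Q]_x f x = \int[P]_x (f x * (h x)%:E).
Proof.
move=> f0 mf; have QP := density_dominates.
rewrite -(Radon_Nikodym_SigmaFinite.change_of_variables QP)//.
have mRN := measurable_int _ (Radon_Nikodym_SigmaFinite.f_integrable QP).
apply: ae_eq_integral => //; [exact: emeasurable_funM..|].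
apply: ae_eqe_mul2l.
exact: ae_eq_trans (ae_eq_Radon_Nikodym_SigmaFinite QP measurableT)
  Radon_Nikodym_density.
Qed.

(** The [Q]-mass of the zero set of [h] is the integral of [h] over that set. *)
Lemma density_ae_gt0 : {ae Q, forall x, (0 < h x)%R}.
Proof.
have mN : measurable [set x | h x = 0%R].
  by have := mh measurableT (measurable_set1 0%R); rewrite setTI.
exists [set x | h x = 0%R]; split => //.
  rewrite QE//; apply: integral0_eq => x /= -> //.
by move=> x /=; rewrite lt_neqAle h0 andbT => /negP; rewrite negbK => /eqP.
Qed.

(* The junk value [ln 0 = 0] is harmless since [h] is positive [Q]-a.e. *)
Lemma integral_lne_density :
  \int[Q]_x lne (('d (charge_of_finite_measure Q) '/d P) x) =
  \int[Q]_x (ln (h x))%:E.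
Proof.
have QP := density_dominates; set g := 'd _ '/d P.
have mfine : measurable_fun setT (fine \o g).
  apply: measurableT_comp => //; apply: measurable_int.
  exact: Radon_Nikodym_integrable.
apply: ae_eq_integral => //.
- rewrite (_ : (fun x => _) = fun x =>
      if ((fine \o g) x <= 0)%R then -oo else (ln ((fine \o g) x))%:E).
    apply: measurable_fun_ifT => //; first exact: measurable_fun_ler.
    by apply/measurable_EFinP; exact: measurableT_comp.
  apply/funext => x /=.
  by rewrite -[in LHS](@fineK _ (g x)) ?Radon_Nikodym_fin_num.
- by apply/measurable_EFinP; exact: measurableT_comp.
(* The equality of the derivative with [h] holds [P]-a.e.; domination carries it over to [Q]. *)
- have := null_dominates_ae_eq measurableT QP Radon_Nikodym_density.
  apply: filterS2 density_ae_gt0 => x hx + _ => /(_ I); rewrite -/(g x) => ->.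
  by rewrite /= leNgt hx.
Qed.

End density.

Lemma KL_density {R : realType} {n : nat} (P Q : probability 'rV[R]_n R)
    (h : 'rV[R]_n -> R) :
  measurable_fun setT h -> (forall x, (0 <= h x)%R) ->
  (forall A, measurable A -> Q A = \int[P]_(x in A) (h x)%:E) ->
  KL Q P = \int[Q]_x (ln (h x))%:E.
Proof.
move=> mh h0 QE.
rewrite /KL (asboolT (density_dominates mh QE)).
by rewrite (integral_lne_density mh h0 QE).
Qed.

(** Here [nu] is the pushforward of [mu] by [phi]; with [phi] a projection, this computes integrals
    of one coordinate under a coupling. *)
Lemma ge0_integral_marginal {d d'} {T : measurableType d}
    {T' : measurableType d'} {R : realType} (mu : {measure set T -> \bar R})
    (nu : {measure set T' -> \bar R}) (phi : T -> T') (g : T' -> \bar R) :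
  measurable_fun setT phi ->
  (forall A, measurable A -> mu (phi @^-1` A) = nu A) ->
  (forall y, 0 <= g y) -> measurable_fun setT g ->
  \int[mu]_x g (phi x) = \int[nu]_y g y.
Proof.
move=> mphi munu g0 mg.
pose phimix := isMeasurableFun.Build _ _ _ _ _ mphi.
pose phi' : {mfun T >-> T'} := HB.pack phi phimix.
rewrite [RHS](eq_measure_integral (pushforward mu phi')).
  by rewrite (ge0_integral_pushforward mphi) ?preimage_setT.
by move=> A mA _; rewrite -munu.
Qed.

(** * Comparison of second moments through the weak transport cost *)

Section transport_lipschitz.
Context {R : realType} {n : nat}.
Implicit Types (P Q : probability 'rV[R]_n R) (f : 'rV[R]_n -> R).

Lemma coupling_lipschitz P Q f pi (p q c c' : R) :
  couplings P Q pi -> (forall x, 0 <= f x)%R ->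
  (forall x y, f x <= f y + enorm (x - y))%R ->
  (0 < c)%R -> (4 * (c * c') = 1)%R ->
  \int[P]_x (f x ^+ 2)%:E = p%:E -> \int[Q]_x (f x ^+ 2)%:E = q%:E ->
  (q - (c * p + c' * q))%:E <= \int[pi]_z (f z.2 * enorm (z.1 - z.2))%:E.
Proof.
move=> [piP piQ] f0 fL c0 cc' Pf Qf.
have mf := continuous_measurable_rV (enorm_lipschitz_continuous fL).
have mf2 : measurable_fun setT (fun x => (f x ^+ 2)%:E).
  by apply/measurable_EFinP; exact: measurable_funX.
have f20 x : 0 <= (f x ^+ 2)%:E by rewrite lee_fin sqr_ge0.
have c'0 : (0 < c')%R by rewrite -(pmulr_rgt0 _ c0); lra.
have m1 : measurable_fun setT (fun z : 'rV[R]_n * 'rV[R]_n => (f z.1 ^+ 2)%:E).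
  exact: (measurableT_comp mf2 measurable_fst).
have m2 : measurable_fun setT (fun z : 'rV[R]_n * 'rV[R]_n => (f z.2 ^+ 2)%:E).
  exact: (measurableT_comp mf2 measurable_snd).
have mI : measurable_fun setT
    (fun z : 'rV[R]_n * 'rV[R]_n => (f z.2 * enorm (z.1 - z.2))%:E).
  apply/measurable_EFinP; apply: measurable_funM; last exact: measurable_enormB.
  exact: (measurableT_comp mf measurable_snd).
have mc1 : measurable_fun setT
    (fun z : 'rV[R]_n * 'rV[R]_n => c%:E * (f z.1 ^+ 2)%:E).
  exact: measurable_funeM.
have mc2 : measurable_fun setT
    (fun z : 'rV[R]_n * 'rV[R]_n => c'%:E * (f z.2 ^+ 2)%:E).
  exact: measurable_funeM.
(* Every term stays on the side where it is non-negative, so the integral splits without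
   integrability; subtraction comes last, with [p] and [q] finite. *)
have : \int[pi]_z (f z.2 ^+ 2)%:E <=
  \int[pi]_z ((f z.2 * enorm (z.1 - z.2))%:E +
    (c%:E * (f z.1 ^+ 2)%:E + c'%:E * (f z.2 ^+ 2)%:E)).
  apply: ge0_le_integral => //.
    by apply: emeasurable_funD => //; exact: emeasurable_funD.
  move=> [x y] _ /=; rewrite lee_fin.
  have := fL y x; rewrite -enormN opprB => fyx.
  have fxy : (f y ^+ 2 <= f y * (f x + enorm (x - y)))%R.
    by rewrite expr2 ler_wpM2l.
  (* Weighted AM-GM: since [4 * (c * c') = 1], completing the square leaves no remainder. *)
  have /eqP cE : (4 * c * (c * f x ^+ 2 + c' * f y ^+ 2) ==
      (2 * c * f x - f y) ^+ 2 + 4 * c * (f x * f y))%R.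
    rewrite -subr_eq0.
    rewrite (_ : _ - _ = (4 * (c * c') - 1) * f y ^+ 2)%R; last by ring.
    by rewrite cc' subrr mul0r.
  have : (f x * f y <= c * f x ^+ 2 + c' * f y ^+ 2)%R.
    have c40 : (0 < 4 * c)%R by rewrite mulr_gt0.
    by rewrite -(ler_pM2l c40) cE lerDr sqr_ge0.
  lra.
have I0 (z : 'rV[R]_n * 'rV[R]_n) : 0 <= (f z.2 * enorm (z.1 - z.2))%:E.
  by rewrite lee_fin mulr_ge0// enorm_ge0.
have c10 (z : 'rV[R]_n * 'rV[R]_n) : 0 <= c%:E * (f z.1 ^+ 2)%:E.
  by rewrite mule_ge0// lee_fin ltW.
have c20 (z : 'rV[R]_n * 'rV[R]_n) : 0 <= c'%:E * (f z.2 ^+ 2)%:E.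
  by rewrite mule_ge0// lee_fin ltW.
rewrite ge0_integralD//; last 2 first.
- by move=> z _; rewrite adde_ge0.
- exact: emeasurable_funD.
rewrite ge0_integralD// !ge0_integralZl_EFin//; [|exact: ltW..].
have -> : \int[pi]_z (f z.2 ^+ 2)%:E = q%:E.
  by rewrite -Qf; exact: ge0_integral_marginal measurable_snd piQ f20 mf2.
have -> : \int[pi]_z (f z.1 ^+ 2)%:E = p%:E.
  by rewrite -Pf; exact: ge0_integral_marginal measurable_fst piP f20 mf2.
by rewrite -!EFinM -EFinD EFinB leeBlDr.
Qed.

(** The lower bound of [coupling_lipschitz] is the same for all couplings, so it bounds the infimum
    at the test function [alpha := f], hence the supremum. *)
Lemma tW2_lipschitz P Q f (p q s : R) :
  (forall x, 0 <= f x)%R -> (forall x y, f x <= f y + enorm (x - y))%R ->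
  (0 <= s)%R ->
  \int[P]_x (f x ^+ 2)%:E = p%:E -> \int[Q]_x (f x ^+ 2)%:E = q%:E ->
  tW2 P Q <= s%:E -> (Num.sqrt q <= Num.sqrt p + s)%R.
Proof.
move=> f0 fL s0 Pf Qf Ws.
have fcont := enorm_lipschitz_continuous fL.
(* The quotient is informative only for [q > 0]; otherwise [Num.sqrt q] is 0 and the claim is
   trivial. *)
have [q0|q0] := leP q 0%R.
  by rewrite ler0_sqrtr// addr_ge0// sqrtr_ge0.
set a := Num.sqrt q; set b0 := Num.sqrt p.
have p0 : (0 <= p)%R.
  by rewrite -lee_fin -Pf integral_ge0// => x _; rewrite lee_fin sqr_ge0.
have a0 : (0 < a)%R by rewrite sqrtr_gt0.
have b00 : (0 <= b0)%R by rewrite sqrtr_ge0.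
have qE : q = (a ^+ 2)%R by rewrite sqr_sqrtr// ltW.
have pE : p = (b0 ^+ 2)%R by rewrite sqr_sqrtr.
apply/ler_addgt0Pr => e e0.
(* [c] and [c'] are the optimal AM-GM weights, up to the [e] that keeps [b]
   invertible when [p = 0]. *)
pose b := (b0 + e)%R; have bp : (0 < b)%R by rewrite ltr_wpDl.
pose c := (a / b / 2)%R; pose c' := (b / a / 2)%R.
have c0 : (0 < c)%R by rewrite !divr_gt0.
have cc' : (4 * (c * c') = 1)%R by rewrite /c /c'; field; rewrite !gt_eqF.
pose L := (q - (c * p + c' * q))%R.
have Ls : (L / a <= s)%R.
  rewrite -lee_fin; apply: le_trans Ws.
  apply: le_trans (ereal_sup_ubound _); last first.
    by exists f => //; exact: continuous_lsc_nneg.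
  apply: le_ereal_inf_tmp => _ [pi cpi <-].
  rewrite Qf /= -/a inver gt_eqF// EFinM lee_wpmul2r//.
    by rewrite lee_fin invr_ge0 ltW.
  exact: (coupling_lipschitz cpi).
(* Both weighted terms are at most [a * b / 2], so [L >= a ^+ 2 - a * b]; dividing [L <= s * a] by
   [a] gives [a <= b + s]. *)
have cp : (c * p <= a * b / 2)%R.
  have -> : (a * b / 2 = c * b ^+ 2)%R by rewrite /c; field; rewrite gt_eqF.
  by rewrite ler_pM2l// pE ler_sqr ?nnegrE// ?(ltW bp)// lerDl ltW.
have c'q : (c' * q = a * b / 2)%R by rewrite /c' qE; field; rewrite gt_eqF.
have : (L <= s * a)%R by rewrite -ler_pdivrMr.
rewrite /L c'q => Lsa.
rewrite -(ler_pM2l a0); rewrite /b in cp c'q Lsa; nra.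
Qed.

End transport_lipschitz.

(** * Conditional and Gibbs measures, with their relative entropies *)

Lemma ge0_bounded_integral_fin_num {d} {T : measurableType d} {R : realType}
    (mu : probability T R) (u : T -> R) (M : R) :
  measurable_fun setT u -> (forall x, 0 <= u x <= M)%R ->
  \int[mu]_x (u x)%:E \is a fin_num.
Proof.
move=> mu_ uM; rewrite ge0_fin_numE; last first.
  by apply: integral_ge0 => x _; rewrite lee_fin; have /andP[] := uM x.
apply: (@le_lt_trans _ _ (\int[mu]_x (cst M%:E x))).
  apply: ge0_le_integral => //.
  - by move=> x _; rewrite lee_fin; have /andP[] := uM x.
  - exact/measurable_EFinP.
  - by move=> x _; rewrite lee_fin; have /andP[] := uM x.
by rewrite integral_cst//= probability_setT mule1 ltry.
Qed.

Section relative_entropy.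
Context {R : realType} {n : nat}.
Variable P : probability 'rV[R]_n R.

(** The measure is [P] conditioned on [A], with density [a^-1] on [A] and 0 elsewhere; positivity of
    the density [Q]-a.e. makes its logarithm the constant [- ln a]. *)
Lemma conditional_probability (A : set 'rV[R]_n) (a : R) :
  measurable A -> P A = a%:E -> (0 < a)%R ->
  exists Q : probability 'rV[R]_n R, KL Q P = (- ln a)%:E /\
    forall f : 'rV[R]_n -> \bar R, (forall x, 0 <= f x) ->
      measurable_fun setT f -> (forall x, A x -> f x = 0) -> \int[Q]_x f x = 0.
Proof.
move=> mA PA a0; pose h x : R := (a^-1 * \1_A x)%R.
have mh : measurable_fun setT h by exact: measurable_funM.
have h0 x : (0 <= h x)%R by rewrite mulr_ge0// invr_ge0 ltW.
have [|Q QE] := @density_probability _ _ _ P h mh h0.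
  rewrite /h; under eq_integral do rewrite EFinM.
  rewrite ge0_integralZl_EFin//; last by rewrite invr_ge0 ltW.
    rewrite integral_indic// setIT [X in _ * X](_ : _ = a%:E)//.
    by rewrite -EFinM mulVf ?gt_eqF.
  by apply/measurable_EFinP; exact: measurable_indic.
exists Q; split.
  rewrite (KL_density mh h0 QE).
  rewrite (ae_eq_integral (cst (- ln a)%:E))//.
  - by rewrite integral_cst//= probability_setT mule1.
  - by apply/measurable_EFinP; exact: measurableT_comp.
  apply: filterS (density_ae_gt0 mh h0 QE) => x + _.
  rewrite /h indicE; case: (x \in A) => /=; last by rewrite mulr0 ltxx.
  by rewrite mulr1 lnV.
move=> f f0 mf fA; rewrite (ge0_integral_density mh QE)//.
apply: integral0_eq => x _; rewrite /h indicE.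
case: (boolP (x \in A)) => [|_] /=; last by rewrite mulr0 mule0.
by rewrite inE => /fA ->; rewrite mul0e.
Qed.

(** With density [expR g / Z], the log-density is [g - ln Z], whose [Q]-mean is [r - ln Z]. Its
    non-negativity is recorded because a square root of this entropy is squared later. *)
Lemma gibbs_probability (g : 'rV[R]_n -> R) (M Z : R) :
  measurable_fun setT g -> (forall x, 0 <= g x <= M)%R ->
  \int[P]_x (expR (g x))%:E = Z%:E ->
  exists (Q : probability 'rV[R]_n R) (r : R),
    [/\ \int[Q]_x (g x)%:E = r%:E, KL Q P = (r - ln Z)%:E & (0 <= r - ln Z)%R].
Proof.
move=> mg gM PZ.
have g0 x : (0 <= g x)%R by have /andP[] := gM x.
have meg : measurable_fun setT (fun x => expR (g x)) by exact: measurableT_comp.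
(* From [g >= 0]; besides [Z > 0], this makes [1 + ln Z] non-negative in the last integral
   comparison. *)
have Z1 : (1 <= Z)%R.
  rewrite -lee_fin -PZ -[leLHS](@probability_setT _ _ _ P).
  rewrite -[leLHS]mul1e -integral_cst//; apply: ge0_le_integral => //.
  - exact/measurable_EFinP.
  - by move=> x _; rewrite lee_fin -expR0 ler_expR.
have Z0 : (0 < Z)%R by exact: lt_le_trans Z1.
pose h x : R := (Z^-1 * expR (g x))%R.
have mh : measurable_fun setT h by exact: measurable_funM.
have h0 x : (0 <= h x)%R by rewrite mulr_ge0// ?invr_ge0 ?ltW ?expR_gt0.
have [|Q QE] := @density_probability _ _ _ P h mh h0.
  rewrite /h; under eq_integral do rewrite EFinM.
  rewrite ge0_integralZl_EFin//.
  - by rewrite PZ -EFinM mulVf ?gt_eqF.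
  - exact/measurable_EFinP.
  - by rewrite invr_ge0 ltW.
have [r Qg] : exists r, \int[Q]_x (g x)%:E = r%:E.
  exists (fine (\int[Q]_x (g x)%:E)).
  by rewrite fineK//; exact: ge0_bounded_integral_fin_num gM.
have mEg : measurable_fun setT (EFin \o g) by exact/measurable_EFinP.
exists Q, r; split => //.
  rewrite (KL_density mh h0 QE).
  rewrite (eq_integral (fun x => (g x)%:E - (ln Z)%:E)); last first.
    move=> x _; rewrite lnM ?posrE ?invr_gt0 ?expR_gt0//.
    by rewrite expRK lnV// addrC EFinB.
  rewrite integralB//=.
  - by rewrite Qg integral_cst//= probability_setT mule1.
  - apply/integrableP; split => //.
    under eq_integral do rewrite /= ger0_norm//.
    by rewrite Qg ltry.
  - by apply/finite_measure_integrable_cst.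
(* Integrate [1 + (ln Z - g) <= Z * exp (- g)] against [Q]; moving [g] to the right
   makes both sides non-negative. *)
rewrite subr_ge0 -(lerD2l 1) -lee_fin.
have mi : measurable_fun setT (fun x => (Z * expR (- g x))%:E).
  apply/measurable_EFinP; apply: measurable_funM => //.
  by apply: measurableT_comp => //; exact: measurableT_comp.
have i0 x : 0 <= (Z * expR (- g x))%:E.
  by rewrite lee_fin mulr_ge0 ?expR_ge0 ?ltW.
(* The factor [Z * expR (- g x)] cancels the density of [Q], leaving the total mass of [P]. *)
have Qi : \int[Q]_x (Z * expR (- g x))%:E = 1.
  rewrite (ge0_integral_density mh QE)//.
  rewrite (eq_integral (cst 1)); last first.
    move=> x _; rewrite /h -EFinM; congr EFin.
    by rewrite mulrACA mulfV ?gt_eqF// mul1r -expRD addNr expR0.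
  by rewrite integral_cst//= probability_setT mule1.
apply: (@le_trans _ _ (\int[Q]_x (cst (1 + ln Z)%:E x))).
  by rewrite integral_cst//= probability_setT mule1.
rewrite [leRHS]EFinD -[X in X + _]Qi -Qg -ge0_integralD//;
  [|by move=> x _; rewrite lee_fin..].
apply: ge0_le_integral => //.
- by move=> x _; rewrite lee_fin addr_ge0// ln_ge0.
- exact: emeasurable_funD.
move=> x _; rewrite -EFinD lee_fin -lerBlDr -addrA.
by rewrite (le_trans (expR_ge1Dx _))// expRD lnK ?posrE.
Qed.

End relative_entropy.

(** * Exponential moment of a bounded Lipschitz function vanishing on [A] *)

Lemma exp_lipschitz_le {R : realType} {n : nat} (C M : R)
    (P : probability 'rV[R]_n R) (A : set 'rV[R]_n) (f : 'rV[R]_n -> R) :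
  (0 < C)%R -> measurable A -> 0 < P A -> tT2 C P -> tT2i C P ->
  (forall x, 0 <= f x <= M)%R -> (forall x y, f x <= f y + enorm (x - y))%R ->
  (forall x, A x -> f x = 0%R) ->
  \int[P]_x (expR (f x ^+ 2 / (4 * C)))%:E <= 1 / P A.
Proof.
move=> C0 mA PA0 T2 T2i fM fL fA.
have f0 x : (0 <= f x)%R by have /andP[] := fM x.
have mf := continuous_measurable_rV (enorm_lipschitz_continuous fL).
have mf2 : measurable_fun setT (fun x => f x ^+ 2)%R by exact: measurable_funX.
have f2M x : (0 <= f x ^+ 2 <= M ^+ 2)%R.
  have /andP[fx0 fxM] := fM x.
  by rewrite sqr_ge0/= ler_pXn2r// nnegrE (le_trans fx0).
have C40 : (0 < 4 * C)%R by rewrite mulr_gt0.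
pose g x : R := (f x ^+ 2 / (4 * C))%R.
have mg : measurable_fun setT g by exact: measurable_funM.
have gM x : (0 <= g x <= M ^+ 2 / (4 * C))%R.
  have /andP[h1 h2] := f2M x.
  by rewrite divr_ge0 ?(ltW C40)//= ler_pM2r ?invr_gt0.
(* Boundedness of [f] makes the moments and the normalizing constant real numbers, so that the final
   inequality can be rearranged. *)
have [a PA] : exists a, P A = a%:E.
  by exists (fine (P A)); rewrite fineK// fin_num_measure.
have a0 : (0 < a)%R by rewrite -lte_fin -PA.
have a1 : (a <= 1)%R by rewrite -lee_fin -PA probability_le1.
have [p Pp] : exists p, \int[P]_x (f x ^+ 2)%:E = p%:E.
  exists (fine (\int[P]_x (f x ^+ 2)%:E)).
  by rewrite fineK//; exact: ge0_bounded_integral_fin_num f2M.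
have [Z PZ] : exists Z, \int[P]_x (expR (g x))%:E = Z%:E.
  exists (fine (\int[P]_x (expR (g x))%:E)).
  rewrite fineK//.
  apply: (@ge0_bounded_integral_fin_num _ _ _ _ _ (expR (M ^+ 2 / (4 * C)))).
    exact: measurableT_comp.
  by move=> x; rewrite expR_ge0 ler_expR; have /andP[] := gM x.
have [Q1 [KL1 Q1f]] := conditional_probability mA PA a0.
have {}Q1f : \int[Q1]_x (f x ^+ 2)%:E = 0%:E.
  apply: Q1f.
  - by move=> x; rewrite lee_fin sqr_ge0.
  - exact/measurable_EFinP.
  - by move=> x /fA ->; rewrite expr0n.
have [Q2 [r [Q2g KL2 K20]]] := gibbs_probability mg gM PZ.
have [q Q2f] : exists q, \int[Q2]_x (f x ^+ 2)%:E = q%:E.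
  exists (fine (\int[Q2]_x (f x ^+ 2)%:E)).
  by rewrite fineK//; exact: ge0_bounded_integral_fin_num f2M.
have rq : (r = q / (4 * C))%R.
  apply: EFin_inj; rewrite -Q2g /g; under eq_integral do rewrite EFinM.
  rewrite ge0_integralZr//.
  - by rewrite Q2f.
  - exact/measurable_EFinP.
  - by move=> x _; rewrite lee_fin sqr_ge0.
  - by rewrite lee_fin invr_ge0 ltW.
have C2 : (0 <= 2 * C)%R by rewrite mulr_ge0// ltW.
have K10 : (0 <= - ln a)%R by rewrite oppr_ge0 ln_le0.
(* [P] is the second argument of the cost here, which calls for [tT2i]; it is the first in the next
   comparison, which calls for [tT2]. *)
have /(tW2_lipschitz f0 fL (sqrtr_ge0 _) Q1f Pp) :
    tW2 Q1 P <= (Num.sqrt (2 * C * - ln a))%:E.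
  by have := T2i Q1; rewrite KL1.
have /(tW2_lipschitz f0 fL (sqrtr_ge0 _) Pp Q2f) :
    tW2 P Q2 <= (Num.sqrt (2 * C * (r - ln Z)))%:E.
  by have := T2 Q2; rewrite KL2.
set s2 := Num.sqrt (2 * C * (r - ln Z)).
set s1 := Num.sqrt (2 * C * - ln a).
rewrite sqrtr0 add0r => sq sp.
have q0 : (0 <= q)%R.
  by rewrite -lee_fin -Q2f integral_ge0// => x _; rewrite lee_fin sqr_ge0.
have s2E : (s2 ^+ 2 = 2 * C * (r - ln Z))%R by rewrite sqr_sqrtr// mulr_ge0.
have s1E : (s1 ^+ 2 = 2 * C * - ln a)%R by rewrite sqr_sqrtr// mulr_ge0.
have s10 : (0 <= s1)%R by exact: sqrtr_ge0.
have s20 : (0 <= s2)%R by exact: sqrtr_ge0.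
have qs : (q <= (s1 + s2) ^+ 2)%R.
  rewrite -[leLHS]sqr_sqrtr// ler_pXn2r// ?nnegrE ?sqrtr_ge0 ?addr_ge0//.
  by rewrite (le_trans sq)// lerD2r.
have qE : q = (4 * C * r)%R by rewrite rq mulrC divfK// gt_eqF.
(* By [(s1 + s2) ^+ 2 <= 2 * s1 ^+ 2 + 2 * s2 ^+ 2], the bound on [q] becomes
   [4 * C * r <= 4 * C * (- ln a + r - ln Z)], where [r] cancels; this fixes the constant
   [4 * C]. *)
have lnZ : (ln Z <= - ln a)%R.
  rewrite -(ler_pM2l C40).
  have := sqr_ge0 (s1 - s2)%R; rewrite qE in qs; nra.
rewrite PZ PA mul1e inver gt_eqF// lee_fin.
have [Z0|Z0] := leP Z 0%R; first by rewrite (le_trans Z0)// invr_ge0 ltW.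
by rewrite -ler_ln ?posrE ?invr_gt0// lnV.
Qed.

(** * Distance to a set, and removal of the truncation *)

Section euclidean_distance.
Context {R : realType} {n : nat}.
Implicit Types (x y : 'rV[R]_n) (B : set 'rV[R]_n).

Lemma edistance_ge0 x B : 0 <= edistance x B.
Proof. by apply: le_ereal_inf_tmp => _ [y _ <-]; rewrite lee_fin enorm_ge0. Qed.

Lemma edistance_eq0 x B : B x -> edistance x B = 0.
Proof.
move=> Bx; apply/eqP; rewrite eq_le edistance_ge0 andbT.
by apply: ereal_inf_lbound; exists x => //; rewrite subrr enorm0.
Qed.

Lemma edistance_fin_num x B : B !=set0 -> edistance x B \is a fin_num.
Proof.
move=> [y By]; rewrite ge0_fin_numE ?edistance_ge0//.
apply: (@le_lt_trans _ _ (enorm (x - y))%:E); last by rewrite ltry.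
by apply: ereal_inf_lbound; exists y.
Qed.

(** Triangle inequality through each point of [B]; the finite term moves to the left so that the
    infimum over [B] is taken last. *)
Lemma edistance_lipschitz x y B :
  edistance x B <= edistance y B + (enorm (x - y))%:E.
Proof.
rewrite -leeBlDr//; apply: le_ereal_inf_tmp => _ [z Bz <-].
rewrite leeBlDr// -EFinD.
apply: (@le_trans _ _ (enorm (x - z))%:E).
  by apply: ereal_inf_lbound; exists z.
rewrite lee_fin [leRHS]addrC (_ : (x - z = (x - y) + (y - z))%R) ?ler_enormD//.
by rewrite subrKA.
Qed.

End euclidean_distance.

Theorem proposition3p7 (R : realType) (n : nat) (C : R)
    (P : probability 'rV[R]_n R) (A : set 'rV[R]_n) :
  (0 < C)%R -> measurable A -> tT2 C P -> tT2i C P ->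
  \int[P]_x expeR (edistance x (convex_hull A) ^+ 2 / (4 * C)%:E) <= 1 / P A.
Proof.
move=> C0 mA T2 T2i; set B := convex_hull A.
(* The inverse of 0 is [+oo], so the bound is trivial for a null [A]. *)
have [PA0|PA0] := eqVneq (P A) 0.
  by rewrite PA0 inve0 mul1e leey.
have {}PA0 : 0 < P A by rewrite lt_neqAle eq_sym PA0 measure_ge0.
have AB : A `<=` B by exact: sub_smallest.
(* Positive mass makes [A], hence [B], nonempty, so the distance is real-valued. *)
have B0 : B !=set0.
  apply/set0P; apply: contraTneq PA0 => B0.
  by move: AB; rewrite B0 subset0 => ->; rewrite measure0 ltxx.
pose delta x := fine (edistance x B).
have deltaE x : edistance x B = (delta x)%:E.
  by rewrite fineK// edistance_fin_num.
have C40 : (0 < 4 * C)%R by rewrite mulr_gt0.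
(* Truncation keeps the Lipschitz bound and the zeros on [A], and is nondecreasing in [k]. *)
pose f k x := Num.min (delta x) k%:R.
have delta0 x : (0 <= delta x)%R by rewrite -lee_fin -deltaE edistance_ge0.
have deltaL x y : (delta x <= delta y + enorm (x - y))%R.
  by rewrite -lee_fin EFinD -!deltaE edistance_lipschitz.
have f0 k x : (0 <= f k x)%R by rewrite /f le_min delta0/=.
have fM k x : (0 <= f k x <= k%:R)%R by rewrite f0/= ge_min lexx orbT.
have fL k x y : (f k x <= f k y + enorm (x - y))%R.
  rewrite /f addr_minl le_min !ge_min deltaL/=.
  by rewrite lerDl enorm_ge0 orbT.
have fA k x : A x -> f k x = 0%R.
  by move=> /AB Bx; rewrite /f /delta edistance_eq0//= min_l.
pose g k x := (expR (f k x ^+ 2 / (4 * C)))%:E.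
have mg k : measurable_fun setT (g k).
  have mf := continuous_measurable_rV (enorm_lipschitz_continuous (fL k)).
  apply/measurable_EFinP; apply: measurableT_comp => //.
  by apply: measurable_funM => //; exact: measurable_funX.
have g0 k x : 0 <= g k x by rewrite lee_fin expR_ge0.
have gnd x : nondecreasing_seq (g ^~ x).
  move=> k l kl; rewrite lee_fin ler_expR ler_pM2r ?invr_gt0//.
  rewrite ler_pXn2r ?nnegrE// /f le_min !ge_min lexx/=.
  by rewrite ler_nat kl orbT.
(* At each [x] the truncation is inactive once [k >= delta x], so [g ^~ x] is eventually constant,
   equal to the integrand. *)
rewrite (eq_integral (fun x => limn (g ^~ x))); last first.
  move=> x _; apply/esym/cvg_lim => //.
  rewrite deltaE -EFin_expe inver gt_eqF// -EFinM/=.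
  apply: cvg_near_cst; near=> k.
  rewrite /g /f min_l//.
  near: k; exact: nbhs_infty_ger.
(* The bound [1 / P A] does not depend on [k], so it survives the limit of the integrals. *)
rewrite monotone_convergence//.
apply: lime_le.
  apply: ereal_nondecreasing_is_cvgn => k l kl.
  by apply: ge0_le_integral => // x _; exact: gnd.
apply: nearW => k.
exact: (exp_lipschitz_le C0 mA PA0 T2 T2i (fM k) (fL k) (fA k)).
Unshelve. all: by end_near. Qed.
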